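(* Let $n\ge 1$ and $\epsilon\in\mathbb R$. For $i=1,\ldots,n$ let $X_i$ be uniform on $[0,2\pi]$ and let $Y_i$ equal $X_i+2\epsilon$ mod $2\pi$, and assume that the pairs $(X_i,Y_i)$ are independent as $i$ varies. Then $X_i\stackrel{d}{=}Y_i$ for every $i$. Moreover, let $f(x_1,\ldots,x_n)=\sin(x_1+\cdots+x_n)$ and, for $i=0,\ldots,n$, let $Z_i=f(X_1,\ldots,X_i,Y_{i+1},\ldots,Y_n)$ (so that the $Z_i$ depend on $\epsilon$). Then $$\lim_{\epsilon\to 0}\frac{E(Z_n-Z_0)^2}{\sum_{i=1}^n E(Z_i-Z_{i-1})^2}=n .$$
   Context: $\stackrel{d}{=}$ denotes equality in distribution. By definition $Z_0=f(Y_1,\ldots,Y_n)$ and $Z_n=f(X_1,\ldots,X_n)$. The limit is over $\epsilon\to 0$ with $\epsilon\ne 0$, $n$ being fixed. *)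

(* Defs.v *)
From HB Require Import structures.
From mathcomp Require Import all_boot all_order all_algebra.
From mathcomp Require Import all_classical all_reals all_analysis.

Set Implicit Arguments.
Unset Strict Implicit.
Unset Printing Implicit Defensive.

Import Order.TTheory GRing.Theory Num.Theory.
Import numFieldNormedType.Exports.

Local Open Scope classical_set_scope.
Local Open Scope ring_scope.

Lemma two_pi_gt0 (R : realType) : 0 < 2 * pi :> R.
Proof. by rewrite mulr_gt0 ?ltr0n ?pi_gt0. Qed.

(* The representative of x modulo 2 pi lying in [0, 2 pi). *)
Definition mod2pi (R : realType) (x : R) : R :=
  x - 2 * pi * (Num.floor (x / (2 * pi)))%:~R.

(* Laws are compared on measurable sets only: [distribution P X] is a total
   set function, whose values on non-measurable sets carry no meaning. *)
Definition uniform_0_2pi (d : measure_display) (T : measurableType d)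
    (R : realType) (P : probability T R) (X : {RV P >-> R}) : Prop :=
  forall A : set R, measurable A ->
    distribution P X A = uniform_prob (two_pi_gt0 R) A.

Definition eq_in_distribution (d : measure_display) (T : measurableType d)
    (R : realType) (P : probability T R) (X Y : {RV P >-> R}) : Prop :=
  forall A : set R, measurable A -> distribution P X A = distribution P Y A.

(* Mutual independence of a finite family of random elements [X i] of [E]:
   the product rule holds for every subfamily [J]. *)
Definition mutually_independent (d d' : measure_display)
    (T : measurableType d) (E : measurableType d') (R : realType)
    (P : probability T R) (I : finType) (X : I -> T -> E) : Prop :=
  forall (J : {set I}) (B : I -> set E), (forall i, measurable (B i)) ->
    P (\bigcap_(i in [set` J]) (X i @^-1` B i)) =
    (\prod_(i in J) P (X i @^-1` B i))%E.

Definition sin_sum (R : realType) (n : nat) (x : 'I_n -> R) : R :=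
  sin (\sum_(j < n) x j).

(* [interpolate f X Y i] is f(X_1, ..., X_i, Y_(i+1), ..., Y_n); ordinals count
   from 0, so X_1, ..., X_i are the [X j] with [j < i]. *)
Definition interpolate (R : realType) (n : nat) (T : Type)
    (f : ('I_n -> R) -> R) (X Y : 'I_n -> T -> R) (i : nat) (w : T) : R :=
  f (fun j => if (j < i)%N then X j w else Y j w).

(* Main.v *)
Require Import Defs.
From HB Require Import structures.
From mathcomp Require Import all_boot all_order all_algebra.
From mathcomp Require Import all_classical all_reals all_analysis.
From mathcomp Require Import measurable_realfun ring lra.

(** Reduction modulo 2 pi is invisible to the sine, so with
    S = X_1 + ... + X_n every Z_i equals sin (S + 2 (n - i) eps), and

      (sin (S + a) - sin (S + b))^2
        = 2 sin^2 ((a - b) / 2) (1 + cos (2 S + a + b)).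

    The mean of cos (2 S + c) vanishes for every c ([phase_sum_mean]), so
    E (Z_i - Z_k)^2 = 2 sin^2 ((i - k) eps) ([expectation_increment]).  The
    quotient is therefore sin^2 (n eps) / (n sin^2 eps) wherever sin eps is
    nonzero, hence near 0, and it tends to n^2 / n = n because sin (a e) / e
    tends to a.

    The equality in law comes from the invariance of the uniform law under
    rotations of the circle ([uniform_prob_rotation]), itself a consequence of
    the translation invariance of Lebesgue measure after cutting [0, 2 pi) in
    two.  The same invariance, used for a quarter turn, changes the sign of
    cos (2 X + c) and so gives it mean zero when X is uniform
    ([uniform_cos_mean]).

    It remains to pass from one phase to the sum of independent phases.
    Independence is a statement about events, whereas the sum calls for
    products of functions of the X_i.  The bridge is [Rintegral_mul_comp_eq0]:
    a bounded phi orthogonal to every event of the form X \in B is orthogonal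
    to every bounded function of X.  In [phase_sum_mean_on_box] the phases are
    added one at a time by this bridge and the addition formula of the cosine;
    the statement proved by induction keeps, for the phases not yet added, the
    indicator of an arbitrary product event, since these indicators are what
    the bridge has to be fed with. *)

Set Implicit Arguments.
Unset Strict Implicit.
Unset Printing Implicit Defensive.
Import Order.TTheory GRing.Theory Num.Theory.
Import numFieldNormedType.Exports.
Local Open Scope classical_set_scope.
Local Open Scope ring_scope.

(** * Integration against a probability *)

Lemma integrable_norm_le d (T : measurableType d) (R : realType)
    (P : probability T R) (f : T -> R) (M : R) :
  measurable_fun setT f -> (forall w, `|f w| <= M) ->
  P.-integrable setT (EFin \o f).
Proof.
move=> mf fM; apply: measurable_bounded_integrable => //.
  by rewrite (le_lt_trans (probability_le1 _ _))// ltry.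
exists M; split; first exact: num_real.
by move=> x Mx w _ /=; rewrite (le_trans (fM w))// ltW.
Qed.

Lemma norm_Rintegral_le d (T : measurableType d) (R : realType)
    (P : probability T R) (f : T -> R) (M : R) :
  measurable_fun setT f -> (forall w, `|f w| <= M) -> `|\int[P]_w f w| <= M.
Proof.
move=> mf fM; have intf := integrable_norm_le P mf fM.
rewrite (le_trans (le_normr_Rintegral _ _))//.
have <- : \int[P]_w cst M w = M.
  by rewrite Rintegral_cst//= probability_setT mulr1.
apply: le_Rintegral => //.
- apply: (@integrable_norm_le _ _ _ _ _ M) => [|w]; last by rewrite normr_id.
  exact: measurableT_comp.
- exact: (@integrable_norm_le _ _ _ _ _ `|M|).
Qed.

Lemma Rintegral_sum d (T : measurableType d) (R : realType)
    (mu : {measure set T -> \bar R}) (I : Type) (s : seq I) (F : I -> T -> R) :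
  (forall i, mu.-integrable setT (EFin \o F i)) ->
  \int[mu]_w (\sum_(i <- s) F i w) = \sum_(i <- s) \int[mu]_w F i w.
Proof.
move=> intF; rewrite /Rintegral.
under eq_integral do rewrite -sumEFin.
rewrite (integral_sum measurableT intF) sum_fine// => i _.
exact: (integrable_fin_num _ (intF i)).
Qed.

Lemma Rintegral_indic d (T : measurableType d) (R : realType)
    (P : probability T R) (A : set T) :
  measurable A -> \int[P]_w \1_A w = fine (P A).
Proof. by move=> mA; rewrite /Rintegral integral_indic// setIT. Qed.

Lemma norm_indic_le1 (T : Type) (R : realType) (A : set T) (w : T) :
  `|\1_A w : R| <= 1.
Proof. by rewrite indicE; case: (_ \in _); rewrite ?normr1 ?normr0. Qed.

Lemma eq_Rintegral_law d (T : measurableType d) (R : realType)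
    (P : probability T R) (X Y : {RV P >-> R}) (F : R -> R) (M : R) :
  eq_in_distribution X Y -> measurable_fun setT F -> (forall x, `|F x| <= M) ->
  \int[P]_w F (X w) = \int[P]_w F (Y w).
Proof.
move=> XY mF FM.
have mEF : measurable_fun setT (EFin \o F) by exact/measurable_EFinP.
have intF (Z : {RV P >-> R}) : P.-integrable setT ((EFin \o F) \o Z).
  by apply: (@integrable_norm_le _ _ _ _ _ M) => //; exact: measurableT_comp.
rewrite /Rintegral -(integral_distribution mEF (intF X)).
rewrite -(integral_distribution mEF (intF Y)); congr fine.
by apply: eq_measure_integral => A mA _; exact: XY.
Qed.

(** The sum is the integer part of [y]. *)
Lemma layer_sum_approx (R : realType) (N : nat) (y : R) :
  0 <= y <= N%:R -> `|y - \sum_(k < N) (k.+1%:R <= y)%R%:R| <= 1.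
Proof.
elim: N => [|N IH] /andP[y0 yN].
  by rewrite big_ord0 subr0 ger0_norm// (le_trans yN).
rewrite big_ord_recr /=; have [yN'|Ny] := leP y N%:R.
  rewrite [X in _ - (_ + X)](_ : _ = 0) ?addr0; first by apply: IH; rewrite y0.
  by rewrite leNgt (le_lt_trans yN')// ltr_nat.
rewrite (eq_bigr (fun=> 1)) => [|k _].
  rewrite sumr_const card_ord -[N.+1%:R]natr1; move: yN; rewrite -natr1 => yN.
  rewrite ler_norml; apply/andP.
  by case: (_ <= y); rewrite /= ?mulr1n ?mulr0n; split; lra.
by rewrite (le_trans _ (ltW Ny))// ler_nat.
Qed.

(** Replacing [g] by the integer part of N g, divided by N, moves the
    integral by at most M / N, and that integer part is a sum of indicators of
    level sets; the integral is thus at most M / N for every N. *)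
Lemma Rintegral_mul_unit_comp_eq0 d (T : measurableType d) (R : realType)
    (P : probability T R) (phi X : T -> R) (g : R -> R) (M : R) :
  measurable_fun setT phi -> measurable_fun setT X -> measurable_fun setT g ->
  (forall w, `|phi w| <= M) -> (forall x, 0 <= g x <= 1) ->
  (forall B : set R, measurable B -> \int[P]_w (phi w * \1_B (X w)) = 0) ->
  \int[P]_w (phi w * g (X w)) = 0.
Proof.
move=> mphi mX mg phiM g01 phi0.
have M0 : 0 <= M by rewrite (le_trans _ (phiM point)).
have mgX : measurable_fun setT (fun w => g (X w)) by exact: measurableT_comp.
pose B (N k : nat) := [set x : R | k.+1%:R <= N%:R * g x].
have mB N k : measurable (B N k).
  rewrite -[B N k]setTI; apply: measurable_fun_le => //.
  exact: measurable_funM.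
have mBX N k : measurable_fun setT (fun w => \1_(B N k) (X w) : R).
  exact: measurableT_comp.
have mphiB N k : measurable_fun setT (fun w => phi w * \1_(B N k) (X w)).
  exact: measurable_funM.
have iB N k : P.-integrable setT (EFin \o (fun w => phi w * \1_(B N k) (X w))).
  apply: (@integrable_norm_le _ _ _ _ _ M) => // w.
  rewrite normrM -[M]mulr1 ler_pM//.
  exact: norm_indic_le1.
have mphig : measurable_fun setT (fun w => phi w * g (X w)).
  exact: measurable_funM.
have ig : P.-integrable setT (EFin \o (fun w => phi w * g (X w))).
  apply: (@integrable_norm_le _ _ _ _ _ M) => // w.
  rewrite normrM -[M]mulr1 ler_pM//.
  by have /andP[g0 g1] := g01 (X w); rewrite ger0_norm.
(* The integer part of N g(X) is a sum of indicators of level sets of g, hence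
   orthogonal to phi; only the fractional part contributes. *)
have IN (N : nat) : N%:R * `|\int[P]_w (phi w * g (X w))| <= M.
  have := @norm_Rintegral_le _ _ _ P
    (fun w => N%:R * (phi w * g (X w)) -
      \sum_(k < N) phi w * \1_(B N k) (X w)) M.
  rewrite RintegralB//; last 2 first.
  - apply: (@integrable_norm_le _ _ _ _ _ (N%:R * M)).
      exact: measurable_funM.
    move=> w; rewrite !normrM normr_nat ler_wpM2l// -[M]mulr1 ler_pM//.
    by have /andP[g0 g1] := g01 (X w); rewrite ger0_norm.
  - apply: (eq_integrable measurableT
        (fun w => \sum_(k < N) (phi w * \1_(B N k) (X w))%:E)%E).
      by move=> w _; rewrite sumEFin.
    by apply: integrable_sum => // k _; exact: iB.
  rewrite (Rintegral_sum _ (fun k : 'I_N => iB N k)) big1 ?subr0; last first.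
    by move=> k _; exact: phi0.
  rewrite RintegralZl// normrM normr_nat; apply.
    by apply: measurable_funB; [exact: measurable_funM|exact: measurable_sum].
  move=> w; rewrite -mulr_sumr mulrCA -mulrBr normrM -[M]mulr1 ler_pM//.
  rewrite (eq_bigr (fun k : 'I_N => (k.+1%:R <= N%:R * g (X w))%R%:R)).
    apply: layer_sum_approx; have /andP[g0 g1] := g01 (X w).
    by rewrite mulr_ge0//= -[leRHS]mulr1 ler_wpM2l.
  move=> k _; rewrite indicE; congr (_ _)%:R.
  by apply/idP/idP; rewrite inE.
apply/eqP/negPn/negP => I0.
have := IN (Num.truncn (M / `|\int[P]_w (phi w * g (X w))|)).+1.
by rewrite -ler_pdivlMr ?normr_gt0// leNgt truncnS_gt.
Qed.

(** Orthogonality to the events [X \in B], a statement that independence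
    provides, is upgraded to functions of [X]: this is how products of functions
    of independent variables are reached below. *)
Lemma Rintegral_mul_comp_eq0 d (T : measurableType d) (R : realType)
    (P : probability T R) (phi X : T -> R) (g : R -> R) (M : R) :
  measurable_fun setT phi -> measurable_fun setT X -> measurable_fun setT g ->
  (forall w, `|phi w| <= M) -> (forall x, `|g x| <= 1) ->
  (forall B : set R, measurable B -> \int[P]_w (phi w * \1_B (X w)) = 0) ->
  \int[P]_w (phi w * g (X w)) = 0.
Proof.
move=> mphi mX mg phiM g1 phi0.
pose h (x : R) := (1 + g x) / 2.
have h01 x : 0 <= h x <= 1.
  by have := g1 x; rewrite ler_norml /h => /andP[? ?]; apply/andP; split; lra.
have mh : measurable_fun setT h.
  by apply: measurable_funM => //; exact: measurable_funD.
have M0 : 0 <= M by rewrite (le_trans _ (phiM point)).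
have ih : P.-integrable setT (EFin \o (fun w => phi w * h (X w))).
  apply: (@integrable_norm_le _ _ _ _ _ M).
    by apply: measurable_funM => //; exact: measurableT_comp.
  move=> w; rewrite normrM -[M]mulr1 ler_pM//.
  by have /andP[h0 h1] := h01 (X w); rewrite ger0_norm.
have iphi : P.-integrable setT (EFin \o (fun w => phi w * \1_setT (X w))).
  by under eq_fun do rewrite indicT mulr1; exact: integrable_norm_le phiM.
have -> : \int[P]_w (phi w * g (X w)) =
    \int[P]_w (2 * (phi w * h (X w)) - phi w * \1_setT (X w)).
  by apply: eq_Rintegral => w _; rewrite /h indicT /=; field.
rewrite RintegralB// ?RintegralZl// ?phi0// ?subr0.
  by rewrite (Rintegral_mul_unit_comp_eq0 mphi mX mh phiM h01 phi0) mulr0.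
exact: (integrableZl measurableT 2 ih).
Qed.

(** * Trigonometry *)

Lemma cosBz (R : realType) (x : R) (k : int) : cos (x - 2 * pi * k%:~R) = cos x.
Proof.
have D (y : R) (m : nat) : cos (y + 2 * pi * m%:R) = cos y.
  by rewrite -[RHS](periodicn (@cosD2pi R) m); congr cos; ring.
case: k => m; first by rewrite -[LHS](D _ m) subrK.
by rewrite -[RHS](D _ m.+1) NegzE intrN mulrN opprK.
Qed.

Lemma sinBz (R : realType) (x : R) (k : int) : sin (x - 2 * pi * k%:~R) = sin x.
Proof. by rewrite -!cosBpihalf addrAC cosBz. Qed.

Lemma norm_cos_le1 (R : realType) (x : R) : `|cos x| <= 1.
Proof. by rewrite ler_norml cos_geN1 cos_le1. Qed.

Lemma measurable_cos_affine (R : realType) (a c : R) :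
  measurable_fun setT (fun x : R => cos (a * x + c)).
Proof.
apply: measurableT_comp.
  by apply: continuous_measurable_fun; exact: continuous_cos.
by apply: measurable_funD => //; exact: measurable_funM.
Qed.

Lemma sin_sub_sqr (R : realType) (s a b : R) :
  (sin (s + a) - sin (s + b)) ^+ 2 =
  2 * sin ((a - b) / 2) ^+ 2 * (1 + cos (2 * s + (a + b))).
Proof.
have -> : s + a = (s + (a + b) / 2) + (a - b) / 2 by field.
have -> : s + b = (s + (a + b) / 2) - (a - b) / 2 by field.
have -> : 2 * s + (a + b) = (s + (a + b) / 2) *+ 2 by field.
by rewrite cos_mulr2n sinD sinB; ring.
Qed.

(** The quotient is the difference quotient of [e |-> sin (a e)] at 0. *)
Lemma cvg_sin_slope (R : realType) (a : R) :
  sin (a * e) / e @[e --> 0^'] --> a.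
Proof.
pose f (e : R) := sin (a * e).
have D : is_derive (0 : R) (1 : R) f a.
  have Da : is_derive (0 : R) (1 : R) ( *%R a) a.
    by apply: is_derive_eq; rewrite scaler1 ?mulr1.
  have := @is_derive1_comp _ _ _ _ _ _ (is_derive_sin (a * 0)) Da.
  by rewrite mulr0 cos0 mul1r.
have : h^-1 *: (f (h *: 1 + 0) - f 0) @[h --> (0 : R)^'] --> 'D_1 f 0.
  exact: (@ex_derive _ _ _ _ _ _ _ D).
rewrite (@derive_val _ _ _ _ _ _ _ D); apply: cvg_trans; apply: near_eq_cvg.
near=> e; rewrite /f mulr0 sin0 subr0 addr0.
by rewrite [e *: 1]mulr1 [_ *: _]mulrC.
Unshelve. all: by end_near.
Qed.

Lemma near_sin_neq0 (R : realType) : \forall e \near (0 : R)^', sin e != 0.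
Proof.
have c1 := @cvg_sin_slope R 1.
near=> e; have : sin (1 * e) / e != 0.
  by near: e; apply: cvgr_neq0 c1 (oner_neq0 R).
by apply: contra => /eqP; rewrite mul1r => ->; rewrite mul0r.
Unshelve. all: by end_near.
Qed.

Lemma cvg_sin_ratio (R : realType) (n : nat) : (0 < n)%N ->
  (sin (n%:R * e) ^+ 2 / (n%:R * sin e ^+ 2) @[e --> (0 : R)^'] --> (n%:R : R)).
Proof.
move=> n0.
have n0' : n%:R != 0 :> R by rewrite pnatr_eq0 -lt0n.
have c1 : sin e / e @[e --> (0 : R)^'] --> (1 : R).
  by have := @cvg_sin_slope R 1; under eq_fun do rewrite mul1r.
have cn := @cvg_sin_slope R n%:R.
have c1V : (sin e / e)^-1 @[e --> (0 : R)^'] --> (1 : R)^-1.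
  by apply: cvgV => //; exact: oner_neq0.
have cr : sin (n%:R * e) / e * (sin e / e)^-1 @[e --> (0 : R)^'] -->
    (n%:R / 1 : R).
  exact: cvgM.
have : (sin (n%:R * e) / e * (sin e / e)^-1) ^+ 2 / n%:R @[e --> (0 : R)^'] -->
    ((n%:R / 1) ^+ 2 / n%:R : R).
  by apply: cvgM; [exact: cvgM|exact: cvg_cst].
rewrite divr1 expr2 mulfK//; apply: cvg_trans; apply: near_eq_cvg.
near=> e.
have e0 : e != 0 by near: e; exact: nbhs_dnbhs_neq.
have s0 : sin e != 0 by near: e; exact: near_sin_neq0.
by rewrite /=; field; rewrite e0 s0 n0'.
Unshelve. all: by end_near.
Qed.

(** * Rotations of the circle *)

Lemma lebesgue_measure_translate (R : realType) (c : R) (A : set R) :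
  measurable A ->
  lebesgue_measure ((fun x => x + c) @^-1` A) = lebesgue_measure A.
Proof.
move=> mA.
have mc : measurable_fun setT
    (fun x : measurableTypeR R => x + c : measurableTypeR R).
  exact: measurable_funD.
pose mfc := isMeasurableFun.Build _ _ _ _ _ mc.
pose f : {mfun (measurableTypeR R) >-> (measurableTypeR R)} :=
  MeasurableFun.Pack (MeasurableFun.Class mfc).
rewrite -[LHS]/(pushforward lebesgue_measure f A).
apply/esym/lebesgue_measure_unique => //= _ [[a b]] _ <-.
rewrite /pushforward [X in _ = _ X](_ : _ = `]a - c, b - c]%classic).
  rewrite !lebesgue_measure_itv/= !lte_fin ltrD2r.
  by case: ifPn => // _; rewrite -!EFinB; congr _%:E; lra.
by apply/seteqP; split => x /=; rewrite !in_itv/= ltrBlDr lerBrDr.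
Qed.

Lemma measurable_mod2pi (R : realType) : measurable_fun setT (@mod2pi R).
Proof.
apply: measurable_funB => //; apply: measurable_funM => //.
apply: nondecreasing_measurable => // x y xy.
by rewrite ler_int le_floor// ler_pM2r// invr_gt0 two_pi_gt0.
Qed.

Lemma measurable_rotation (R : realType) (t : R) :
  measurable_fun setT (fun x : R => mod2pi (x + t)).
Proof.
apply: measurableT_comp; first exact: measurable_mod2pi.
exact: measurable_funD.
Qed.

Lemma mod2pi_itv (R : realType) (x : R) : 0 <= mod2pi x < 2 * pi.
Proof.
rewrite /mod2pi; move: (2 * pi) (two_pi_gt0 R) => p p0.
have /andP[] := floor_itv (x / p).
rewrite ler_pdivlMr// ltr_pdivrMr// intrD mulrDl mul1r => h1 h2.
by rewrite subr_ge0 mulrC h1 ltrBlDr addrC.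
Qed.

Lemma mod2pi_id (R : realType) (x : R) : 0 <= x < 2 * pi -> mod2pi x = x.
Proof.
move=> /andP[x0 x1]; rewrite /mod2pi (@floor_def _ _ 0) ?mulr0 ?subr0//.
by rewrite mulr_ge0 ?invr_ge0 ?(ltW (two_pi_gt0 R))//= add0r
  ltr_pdivrMr ?two_pi_gt0// mul1r.
Qed.

Lemma mod2piB (R : realType) (x : R) (k : int) :
  mod2pi (x - 2 * pi * k%:~R) = mod2pi x.
Proof.
rewrite /mod2pi; move: (2 * pi) (two_pi_gt0 R) => p p0.
have -> : (x - p * k%:~R) / p = x / p + (- k)%:~R.
  by rewrite intrN; field; rewrite gt_eqF.
by rewrite floorDrz ?intr_int// intrKfloor intrD !intrN; ring.
Qed.

(** The half-open interval is the one that [mod2pi] maps onto. *)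
Lemma uniform_probE (R : realType) (A : set R) : measurable A ->
  uniform_prob (two_pi_gt0 R) A =
  ((2 * pi)^-1%:E * lebesgue_measure (A `&` `[0%R, (2 * pi)%R[%classic))%E.
Proof.
move=> mA; rewrite /uniform_prob integral_uniform_pdf.
rewrite (eq_integral (cst (2 * pi)^-1%:E)); last first.
  move=> x; rewrite inE /= in_itv/= => -[_ xI].
  by rewrite /uniform_pdf xI subr0.
rewrite integral_cst; last exact: measurableI.
congr (_ * _)%E; rewrite -(@setUitv1 _ _ _ _ true); last first.
  by rewrite bnd_simp ltW// two_pi_gt0.
rewrite setIUr measureU0//; try exact: measurableI.
apply/eqP; rewrite eq_le measure_ge0 andbT -(lebesgue_measure_set1 (2 * pi)).
by apply: le_measure; rewrite ?inE//; exact: measurableI.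
Qed.

(** A rotation by s in [0, 2 pi) is a translation by s on the points below
    2 pi - s and a translation by s - 2 pi on the others. *)
Lemma uniform_prob_rotation (R : realType) (t : R) (A : set R) : measurable A ->
  uniform_prob (two_pi_gt0 R) ((fun x : R => mod2pi (x + t)) @^-1` A) =
  uniform_prob (two_pi_gt0 R) A.
Proof.
move=> mA; have mB : measurable ((fun x : R => mod2pi (x + t)) @^-1` A).
  by rewrite -[_ @^-1` _]setTI; exact: measurable_rotation.
rewrite !uniform_probE//; congr (_ * _)%E.
have [s /andP[s0 s1] rotE] : exists2 s : R, 0 <= s < 2 * pi &
    forall x, mod2pi (x + t) = mod2pi (x + s).
  exists (mod2pi t) => [|x]; first exact: mod2pi_itv.
  by rewrite [mod2pi t]/mod2pi addrA mod2piB.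
have splitAt (r : R) (B : set R) : 0 <= r <= 2 * pi -> measurable B ->
    lebesgue_measure (B `&` `[0, 2 * pi[%classic) =
    (lebesgue_measure (B `&` `[0%R, r[%classic) +
     lebesgue_measure (B `&` `[r, (2 * pi)%R[%classic))%E.
  move=> /andP[r0 r1] mB'; rewrite -measureU; try exact: measurableI.
    by rewrite -setIUr -itv_bndbnd_setU// bnd_simp.
  have disj (x : R) : x \in `[0, r[ -> x \in `[r, 2 * pi[ -> False.
    rewrite !in_itv /= => /andP[_ xr] /andP[rx _].
    by move: xr; rewrite ltNge rx.
  by apply/seteqP; split => // x [[_ xr] [_ rx]]; exact: disj xr rx.
rewrite (splitAt (2 * pi - s))//; last by apply/andP; split; lra.
rewrite [RHS](splitAt s)//; last by rewrite s0 ltW.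
(* The arc [2 pi - s, 2 pi) wraps around and lands on [0, s); the arc
   [0, 2 pi - s) lands on [s, 2 pi). *)
rewrite addeC; congr (_ + _)%E.
  rewrite -[RHS](lebesgue_measure_translate (s - 2 * pi)); last first.
    exact: measurableI.
  congr lebesgue_measure; apply/seteqP.
  split => x /=; rewrite !(@in_itv _ R) /= rotE.
    move=> [xA /andP[x0 x1]]; move: xA; rewrite -(mod2piB _ 1) mod2pi_id.
      by rewrite mulr1 addrA => ?; split => //; apply/andP; split; lra.
    by apply/andP; split; lra.
  move=> [xA /andP[x0 x1]]; split; last by apply/andP; split; lra.
  rewrite -(mod2piB _ 1) mod2pi_id ?mulr1 -?addrA//.
  by apply/andP; split; lra.
rewrite -[RHS](lebesgue_measure_translate s); last exact: measurableI.
congr lebesgue_measure; apply/seteqP.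
split => x /=; rewrite !(@in_itv _ R) /= rotE.
  move=> [xA /andP[x0 x1]]; move: xA; rewrite mod2pi_id.
    by move=> ?; split => //; apply/andP; split; lra.
  by apply/andP; split; lra.
move=> [xA /andP[x0 x1]]; split; last by apply/andP; split; lra.
by rewrite mod2pi_id//; apply/andP; split; lra.
Qed.

Lemma uniform_rotation d (T : measurableType d) (R : realType)
    (P : probability T R) (X : {RV P >-> R}) (t : R) (A : set R) :
  uniform_0_2pi X -> measurable A ->
  P ((fun w => mod2pi (X w + t)) @^-1` A) = uniform_prob (two_pi_gt0 R) A.
Proof.
move=> uX mA; rewrite -(uniform_prob_rotation t mA) -uX//.
by rewrite -[_ @^-1` _]setTI; exact: measurable_rotation.
Qed.

(** A quarter turn preserves the law of [X] and adds pi to the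
    phase [2 X + c]. *)
Lemma uniform_cos_mean d (T : measurableType d) (R : realType)
    (P : probability T R) (X : {RV P >-> R}) (c : R) :
  uniform_0_2pi X -> \int[P]_w cos (2 * X w + c) = 0.
Proof.
move=> uX.
have mF := measurable_cos_affine 2 c.
have F1 (x : R) : `|cos (2 * x + c)| <= 1 by exact: norm_cos_le1.
have mrot : measurable_fun setT (fun w => mod2pi (X w + pi / 2)).
  exact: (measurableT_comp (measurable_rotation _)).
pose mY := isMeasurableFun.Build _ _ _ _ _ mrot.
pose Y : {RV P >-> R} := MeasurableFun.Pack (MeasurableFun.Class mY).
have XY : eq_in_distribution X Y.
  by move=> A mA; rewrite uX// -(uniform_rotation (pi / 2) uX mA).
have iF : P.-integrable setT (EFin \o (fun w => cos (2 * X w + c))).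
  apply: (@integrable_norm_le _ _ _ _ _ 1) => //.
  exact: (measurableT_comp mF).
(* The winding number k of the rotation is doubled with the frequency. *)
have : \int[P]_w cos (2 * Y w + c) = \int[P]_w (- 1 * cos (2 * X w + c)).
  apply: eq_Rintegral => w _; rewrite /Y /= /mod2pi.
  set k := Num.floor _.
  have -> : 2 * (X w + pi / 2 - 2 * pi * k%:~R) + c =
    2 * X w + c + pi - 2 * pi * (2 * k)%:~R by rewrite intrM; field.
  by rewrite cosBz cosDpi mulN1r.
rewrite -(eq_Rintegral_law XY mF F1) RintegralZl//.
by set I := Rintegral _ _ _ => II; lra.
Qed.

(** * Independent phases *)

Lemma mutually_independent_fst d (T : measurableType d) (R : realType)
    (P : probability T R) (I : finType) (X Y : I -> T -> R) :
  mutually_independent P (fun i w => (X i w, Y i w)) ->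
  mutually_independent P X.
Proof.
move=> XY J B mB.
have E i : (fun w => (X i w, Y i w)) @^-1` (B i `*` setT) = X i @^-1` B i.
  by apply/seteqP; split => w /=; [case|].
transitivity (P (\bigcap_(i in [set` J])
    (fun w => (X i w, Y i w)) @^-1` (B i `*` setT))).
  by congr (P _); apply: eq_bigcapr => i _; rewrite E.
rewrite (XY J (fun i => B i `*` setT)) => [|i]; last exact: measurableX.
by apply: eq_bigr => i _; rewrite E.
Qed.

Section independent_phases.
Context d (T : measurableType d) (R : realType) (P : probability T R).
Context (I : finType) (X : I -> {RV P >-> R}).
Hypothesis X_indep : mutually_independent P (fun i w => X i w).

Let box (J : {set I}) (B : I -> set R) : set T :=
  \bigcap_(i in [set` J]) X i @^-1` B i.

Let extend (i : I) (C : set R) (B : I -> set R) j := if j == i then C else B j.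

Let measurable_extend i C B : measurable C -> (forall j, measurable (B j)) ->
  forall j, measurable (extend i C B j).
Proof. by move=> mC mB j; rewrite /extend; case: eqP. Qed.

Let measurable_preim i (B : set R) : measurable B -> measurable (X i @^-1` B).
Proof. by move=> mB; rewrite -[_ @^-1` _]setTI; exact: measurable_funP. Qed.

Let measurable_box J B : (forall i, measurable (B i)) -> measurable (box J B).
Proof.
by move=> mB; apply: fin_bigcap_measurable => // i _; exact: measurable_preim.
Qed.

Let box_setU1 (i : I) (J : {set I}) C B : i \notin J ->
  box (i |: J) (extend i C B) = box J B `&` X i @^-1` C.
Proof.
move=> iJ; have E j : j \in J -> extend i C B j = B j.
  by rewrite /extend; case: eqP => // -> iJ'; rewrite iJ' in iJ.
have Ei : extend i C B i = C by rewrite /extend eqxx.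
apply/seteqP; split => w.
  move=> H; split; last by rewrite -Ei; apply: H; rewrite /= setU11.
  by move=> j /= jJ; rewrite -E//; apply: H; rewrite /= in_setU1 jJ orbT.
move=> [H1 H2] j /=; rewrite in_setU1 => /predU1P[->|jJ]; first by rewrite Ei.
by rewrite E//; exact: H1.
Qed.

Let box_indep (i : I) (J : {set I}) C B : i \notin J -> measurable C ->
  (forall j, measurable (B j)) ->
  P (box J B `&` X i @^-1` C) = (P (box J B) * P (X i @^-1` C))%E.
Proof.
move=> iJ mC mB; rewrite -box_setU1// X_indep; last exact: measurable_extend.
rewrite big_setU1//= {1}/extend eqxx muleC; congr (_ * _)%E.
rewrite X_indep//; apply: eq_bigr => j jJ; rewrite /extend.
by case: eqP => // ji; rewrite ji (negbTE iJ) in jJ.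
Qed.

(** The box makes the induction go through: to add the phase [X i] one needs
    the previous sum to be orthogonal to the events on [X i] while the event on
    the remaining phases is kept.  The phase shift [c] is universally quantified
    because the addition formula replaces a cosine by a sine. *)
Lemma phase_sum_mean_on_box (i0 : I) (s : seq I) (J : {set I}) (B : I -> set R)
    (c : R) :
  uniform_0_2pi (X i0) -> uniq (i0 :: s) ->
  {in i0 :: s, forall i, i \notin J} ->
  (forall i, measurable (B i)) ->
  \int[P]_w (\1_(box J B) w * cos (2 * (X i0 w + \sum_(i <- s) X i w) + c)) = 0.
Proof.
move=> u0; elim: s J B c => [|i s IH] J B c us sJ mB; last first.
  have [i0s iJ si] : [/\ uniq (i0 :: s), i \notin J & i \notin i0 :: s].
    have /= /and3P[+ si us'] := us; rewrite !inE !negb_or => /andP[i0i i0s].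
    rewrite i0s us' eq_sym i0i si; split => //.
    by apply: sJ; rewrite !inE eqxx orbT.
  (* Restricting [phi b] to an event on X_i amounts to adding i to the box, so
     the induction hypothesis is what orthogonality asks for. *)
  pose phi b w := \1_(box J B) w * cos (2 * (X i0 w + \sum_(i <- s) X i w) + b).
  have mphi b : measurable_fun setT (phi b).
    apply: measurable_funM.
      by apply: measurable_indic; exact: measurable_box.
    apply: (measurableT_comp (measurable_cos_affine 2 b)).
    by apply: measurable_funD => //; exact: measurable_sum.
  have phi1 b w : `|phi b w| <= 1.
    by rewrite normrM -[1]mulr1 ler_pM ?norm_indic_le1 ?norm_cos_le1.
  have phi0 b e : \int[P]_w (phi b w * cos (2 * X i w + e)) = 0.
    have mcos := measurable_cos_affine 2 e.
    apply: (@Rintegral_mul_comp_eq0 _ _ _ P (phi b) (X i)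
        (fun x => cos (2 * x + e)) 1) => // [x|C mC]; first exact: norm_cos_le1.
    rewrite -[RHS](IH (i |: J) (extend i C B) b)//; last 2 first.
    - move=> j js; rewrite in_setU1 negb_or; apply/andP; split.
        by apply: contraNneq si => <-.
      by apply: sJ; move: js; rewrite !inE => /orP[->//|->]; rewrite !orbT.
    - exact: measurable_extend.
    apply: eq_Rintegral => w _; rewrite /phi box_setU1// indicI /=.
    by rewrite mulrAC.
  have iphi b e :
      P.-integrable setT (EFin \o (fun w => phi b w * cos (2 * X i w + e))).
    apply: (@integrable_norm_le _ _ _ _ _ 1).
      apply: measurable_funM => //.
      exact: (measurableT_comp (measurable_cos_affine 2 e)).
    by move=> w; rewrite normrM -[1]mulr1 ler_pM ?phi1 ?norm_cos_le1.
  (* cos (u + 2 X_i) is expanded, each sine being written as a cosine delayed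
     by pi / 2, so that both terms fall under phi0. *)
  rewrite (@eq_Rintegral _ _ _ P setT (fun w => phi c w * cos (2 * X i w + 0) -
    phi (c - pi / 2) w * cos (2 * X i w + - (pi / 2)))).
    by rewrite RintegralB// !phi0 subr0.
  move=> w _; rewrite /phi big_cons addr0 cosBpihalf (addrA _ c) cosBpihalf.
  set S := \sum_(_ <- _) _ .
  have -> : 2 * (X i0 w + (X i w + S)) + c =
    (2 * (X i0 w + S) + c) + 2 * X i w by ring.
  by rewrite cosD; ring.
(* Base case: the event [box J B], centred by its probability q, is
   orthogonal to every event on X_i0, by independence. *)
have mD := measurable_box J mB.
set q := fine (P (box J B)).
have mphi : measurable_fun setT (fun w => \1_(box J B) w - q).
  by apply: measurable_funB => //; exact: measurable_indic.
have phiM w : `|\1_(box J B) w - q| <= 1 + `|q|.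
  by rewrite (le_trans (ler_normB _ _))// lerD2r norm_indic_le1.
have i1 (A : set T) : measurable A ->
    P.-integrable setT (EFin \o (\1_A : T -> R)).
  move=> mA; apply: (@integrable_norm_le _ _ _ _ _ 1).
    exact: measurable_indic.
  exact: norm_indic_le1.
have phi0 (C : set R) : measurable C ->
    \int[P]_w ((\1_(box J B) w - q) * \1_C (X i0 w)) = 0.
  move=> mC; have mXC := measurable_preim i0 mC.
  rewrite (@eq_Rintegral _ _ _ P setT
    (fun w => \1_(box J B `&` X i0 @^-1` C) w -
       q * \1_(X i0 @^-1` C) w)).
    have mI : measurable (box J B `&` X i0 @^-1` C) by exact: measurableI.
    have i2 := i1 _ mXC; have i3 := integrableZl measurableT q i2.
    rewrite RintegralB ?RintegralZl ?Rintegral_indic//; last exact: i1.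
    rewrite box_indep//; last by apply: sJ; rewrite inE.
    by rewrite fineM ?fin_num_measure// subrr.
  by move=> w _; rewrite indicI /= mulrBl.
have H := Rintegral_mul_comp_eq0 mphi (measurable_funPT (X i0))
  (measurable_cos_affine 2 c) phiM (fun x => norm_cos_le1 (2 * x + c)) phi0.
rewrite (@eq_Rintegral _ _ _ P setT
  (fun w => (\1_(box J B) w - q) * cos (2 * X i0 w + c) +
     q * cos (2 * X i0 w + c))); last first.
  by move=> w _; rewrite big_nil addr0 mulrBl subrK.
have icos : P.-integrable setT (EFin \o (fun w => cos (2 * X i0 w + c))).
  apply: (@integrable_norm_le _ _ _ _ _ 1) => [|w]; last exact: norm_cos_le1.
  exact: (measurableT_comp (measurable_cos_affine 2 c)).
rewrite RintegralD//; last 2 first.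
- apply: (@integrable_norm_le _ _ _ _ _ (1 + `|q|)).
    apply: measurable_funM => //.
    exact: (measurableT_comp (measurable_cos_affine 2 c)).
  by move=> w; rewrite normrM -[leRHS]mulr1 ler_pM ?norm_cos_le1.
- exact: (integrableZl measurableT q icos).
by rewrite H RintegralZl// (uniform_cos_mean c u0) mulr0 addr0.
Qed.

End independent_phases.

Lemma phase_sum_mean d (T : measurableType d) (R : realType)
    (P : probability T R) (I : finType) (X : I -> {RV P >-> R})
    (i0 : I) (c : R) :
  mutually_independent P (fun i w => X i w) -> uniform_0_2pi (X i0) ->
  \int[P]_w cos (2 * (\sum_i X i w) + c) = 0.
Proof.
move=> Xind u0.
pose s := rem i0 (enum I).
have es : perm_eq (enum I) (i0 :: s) by apply: perm_to_rem; rewrite mem_enum.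
have us : uniq (i0 :: s) by rewrite -(perm_uniq es) enum_uniq.
have H := @phase_sum_mean_on_box _ _ _ _ _ _ Xind i0 s finset.set0
  (fun=> setT) c u0 us.
rewrite -[RHS]H//; last by move=> i _; rewrite inE.
apply: eq_Rintegral => w _; rewrite (_ : \bigcap_(_ in _) _ = setT).
  by rewrite indicT mul1r -big_enum (perm_big _ es) big_cons.
by apply/seteqP; split => // v _ i.
Qed.

(** * Increments of the sine of the sum *)

Lemma sin_sum_interpolate (R : realType) (n i : nat) (T : Type) (eps : R)
    (X Y : 'I_n -> T -> R) (w : T) :
  (i <= n)%N -> (forall j, Y j w = mod2pi (X j w + 2 * eps)) ->
  interpolate (@sin_sum R n) X Y i w =
  sin (\sum_j X j w + 2 * eps * (n - i)%:R).
Proof.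
move=> le_in YE; rewrite /interpolate /sin_sum.
(* k j is the number of turns removed by the reduction of Y_j. *)
pose k (j : 'I_n) : int :=
  if (j < i)%N then 0 else Num.floor ((X j w + 2 * eps) / (2 * pi)).
rewrite -[RHS](sinBz _ (\sum_j k j)); congr sin.
have -> : 2 * eps * (n - i)%:R =
    \sum_(j < n) (if (j < i)%N then 0 else 2 * eps).
  rewrite -(big_mkord xpredT (fun j => if (j < i)%N then 0 else 2 * eps)).
  rewrite (big_cat_nat (n := i))//= big_nat big1 ?add0r => [|j /andP[_ ->]//].
  rewrite big_nat (eq_bigr (fun=> 2 * eps)) => [|j /andP[]].
    by rewrite -big_nat sumr_const_nat mulr_natr.
  by rewrite leqNgt => /negbTE ->.
rewrite rmorph_sum mulr_sumr -sumrN -!big_split /=; apply: eq_bigr => j _.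
by rewrite /k; case: ifP => _; rewrite ?mulr0 ?subr0 ?addr0 ?YE.
Qed.

Lemma expectation_increment d (T : measurableType d) (R : realType)
    (P : probability T R) (I : finType) (X : I -> {RV P >-> R}) (i0 : I)
    (a b : R) :
  mutually_independent P (fun i w => X i w) -> uniform_0_2pi (X i0) ->
  ('E_P[fun w => ((sin (\sum_i X i w + a) - sin (\sum_i X i w + b)) ^+ 2)%R] =
  (2 * sin ((a - b) / 2) ^+ 2)%:E)%E.
Proof.
move=> Xind u0; rewrite unlock.
set r := 2 * _.
pose C w := cos (2 * (\sum_i X i w) + (a + b)).
have mC : measurable_fun setT C.
  apply: (measurableT_comp (measurable_cos_affine 2 (a + b))).
  exact: measurable_sum.
have i1C : P.-integrable setT (EFin \o (fun w => 1 + C w)).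
  apply: (@integrable_norm_le _ _ _ _ _ 2); first exact: measurable_funD.
  by move=> w; rewrite (le_trans (ler_normD _ _))// normr1 lerD2l norm_cos_le1.
have iC : P.-integrable setT (EFin \o C).
  by apply: (@integrable_norm_le _ _ _ _ _ 1) => // w; exact: norm_cos_le1.
have ic : P.-integrable setT (EFin \o (fun w => r * (1 + C w))).
  exact: (integrableZl measurableT r i1C).
under eq_integral do rewrite sin_sub_sqr.
rewrite -[LHS]fineK; last exact: (integrable_fin_num _ ic).
congr _%:E; rewrite -[LHS]/(\int[P]_w (r * (1 + C w))) RintegralZl//.
rewrite RintegralD//; last first.
  by apply: (@integrable_norm_le _ _ _ _ _ 1) => // w; rewrite normr1.
rewrite (phase_sum_mean _ Xind u0) addr0 Rintegral_cst//=.
by rewrite probability_setT !mulr1.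
Qed.

Theorem proposition3 (R : realType) (n : nat) (n_ge1 : (1 <= n)%N)
    (d : R -> measure_display) (T : forall eps : R, measurableType (d eps))
    (P : forall eps : R, probability (T eps) R)
    (X Y : forall eps : R, 'I_n -> {RV (P eps) >-> R})
    (X_uniform : forall (eps : R) (i : 'I_n), uniform_0_2pi (X eps i))
    (Y_def : forall (eps : R) (i : 'I_n) (w : T eps),
      Y eps i w = mod2pi (X eps i w + 2 * eps))
    (XY_indep : forall eps : R,
      mutually_independent (P eps)
        (fun (i : 'I_n) (w : T eps) => (X eps i w, Y eps i w))) :
  let Z (eps : R) (i : nat) : T eps -> R :=
    interpolate (@sin_sum R n) (X eps) (Y eps) i in
  (forall (eps : R) (i : 'I_n), eq_in_distribution (X eps i) (Y eps i)) /\
  ((fun eps : R =>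
     ('E_(P eps)[fun w => ((Z eps n w - Z eps 0%N w) ^+ 2)%R] /
      \sum_(1 <= i < n.+1)
        'E_(P eps)[fun w => ((Z eps i w - Z eps i.-1 w) ^+ 2)%R])%E)
     @ 0^' --> (n%:R)%:E).
Proof.
move=> Z; split => [eps i A mA|].
  rewrite X_uniform// -(uniform_rotation (2 * eps) (X_uniform eps i) mA).
  by congr (P eps _); apply/seteqP; split => w /=; rewrite Y_def.
pose i0 : 'I_n := Ordinal n_ge1.
have ZE eps i w : (i <= n)%N ->
    Z eps i w = sin (\sum_j X eps j w + 2 * eps * (n - i)%:R).
  by move=> le_in; apply: sin_sum_interpolate => // j; exact: Y_def.
have EZ eps i k : (i <= n)%N -> (k <= n)%N ->
    ('E_(P eps)[fun w => ((Z eps i w - Z eps k w) ^+ 2)%R] =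
    (2 * sin (eps * ((n - i)%:R - (n - k)%:R)) ^+ 2)%:E)%E.
  move=> le_in le_kn.
  have Xind := mutually_independent_fst (XY_indep eps).
  have -> : eps * ((n - i)%:R - (n - k)%:R) =
    (2 * eps * (n - i)%:R - 2 * eps * (n - k)%:R) / 2 by field.
  rewrite -(expectation_increment _ _ Xind (X_uniform eps i0)).
  by congr expectation; apply/funext => w; rewrite !ZE.
have numE eps : ('E_(P eps)[fun w => ((Z eps n w - Z eps 0%N w) ^+ 2)%R] =
    (2 * sin (n%:R * eps) ^+ 2)%:E)%E.
  by rewrite EZ// subnn subn0 sub0r mulrN sinN sqrrN (mulrC eps).
have denE eps : (\sum_(1 <= i < n.+1)
    'E_(P eps)[fun w => ((Z eps i w - Z eps i.-1 w) ^+ 2)%R] =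
    (n%:R * (2 * sin eps ^+ 2))%:E)%E.
  rewrite big_nat (eq_bigr (fun=> (2 * sin eps ^+ 2)%:E)).
    by rewrite -big_nat sumEFin sumr_const_nat subn1 (mulr_natl _ n).
  case=> // i /andP[_ lt_in]; rewrite EZ//=; last exact: ltnW.
  rewrite -(@subnSK i n lt_in) -[X in _ - X]natr1 opprD addrA subrr add0r.
  by rewrite mulrN1 sinN sqrrN.
have ratioE eps : sin eps != 0 ->
    ('E_(P eps)[fun w => ((Z eps n w - Z eps 0%N w) ^+ 2)%R] /
      \sum_(1 <= i < n.+1)
        'E_(P eps)[fun w => ((Z eps i w - Z eps i.-1 w) ^+ 2)%R] =
    (sin (n%:R * eps) ^+ 2 / (n%:R * sin eps ^+ 2))%:E)%E.
  move=> s0; have n0 : n%:R != 0 :> R by rewrite pnatr_eq0 -lt0n.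
  rewrite numE denE inver ifN; last first.
    by rewrite mulf_neq0// mulf_neq0 ?expf_neq0// pnatr_eq0.
  by rewrite -EFinM; congr _%:E; field; rewrite s0 n0.
apply: (@cvg_trans _ ((sin (n%:R * e) ^+ 2 / (n%:R * sin e ^+ 2))%:E
    @[e --> (0 : R)^'])).
  apply: near_eq_cvg; near=> e; rewrite ratioE//.
  near: e; exact: near_sin_neq0.
by apply: cvg_EFin; [near=> e|exact: cvg_sin_ratio].
Unshelve. all: by end_near.
Qed.
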